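(* Let $F\subset\mathbb{R}^2$ be an unbounded convex polygon with non-parallel sides and exactly two vertices (so $F$ has three sides: one bounded segment and two unbounded rays, and the two unbounded sides are not parallel). Then there exist $S\subset T\subset\mathbb{R}^2$, with $|S|=2$ and $|T|=4$, such that $V_T(S)=F$.
   Context: For a finite nonempty set $T\subset\mathbb{R}^n$ and a nonempty proper subset $S\subset T$, the multipoint (higher order) Voronoi cell is $$V_T(S):=\left\{x\in\mathbb{R}^n : \max_{s\in S}\|x-s\|\le\min_{t\in T\setminus S}\|x-t\|\right\},$$ where $\|\cdot\|$ is the Euclidean norm. An unbounded convex polygon is an unbounded intersection of finitely many closed halfplanes in $\mathbb{R}^2$ with nonempty interior; its sides are its one-dimensional faces and its vertices are its extreme points. *)

(* Defs.v *)
(* MathComp-Analysis; the real line is an arbitrary [R : realType] and R^n is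
   ['rV[R]_n]. *)
From mathcomp Require Import all_boot all_order all_algebra finmap.
From mathcomp Require Import all_classical all_reals all_analysis.

Set Implicit Arguments.
Unset Strict Implicit.
Unset Printing Implicit Defensive.

Import Order.TTheory GRing.Theory Num.Theory.
Import numFieldNormedType.Exports.

Local Open Scope classical_set_scope.
Local Open Scope ring_scope.

Definition dotp (R : realType) (n : nat) (x y : 'rV[R]_n) : R :=
  \sum_(i < n) x 0 i * y 0 i.

(* The library norm [`|x|] on ['rV[R]_n] is the sup norm, so the Euclidean one
   is defined here. *)
Definition enorm (R : realType) (n : nat) (x : 'rV[R]_n) : R :=
  Num.sqrt (dotp x x).

(* The extrema are taken in [\bar R] because its bounds are the neutral
   elements of [maxe] and [mine]; when [S] is nonempty and proper in [T] both
   sides are finite and are the usual maximum and minimum. *)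
Definition voronoi_cell (R : realType) (n : nat) (T S : {fset 'rV[R]_n}) :
    set 'rV[R]_n :=
  [set x | (\big[maxe/-oo]_(s <- S) (enorm (x - s))%:E <=
            \big[mine/+oo]_(t <- (T `\` S)%fset) (enorm (x - t))%:E)%E].

Definition closed_halfplane (R : realType) (H : set 'rV[R]_2) : Prop :=
  exists2 a : 'rV[R]_2, a != 0 &
    exists b : R, H = [set x | dotp a x <= b].

(* [bounded_set] and the interior refer to the sup norm, which defines the same
   bounded sets and the same topology as the Euclidean norm. *)
Definition unbounded_convex_polygon (R : realType) (F : set 'rV[R]_2) : Prop :=
  [/\ exists (k : nat) (H : 'I_k -> set 'rV[R]_2),
        (forall i, closed_halfplane (H i)) /\ F = \bigcap_i H i,
      F° !=set0 &
      ~ bounded_set F].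

Definition face (R : realType) (n : nat) (F G : set 'rV[R]_n) : Prop :=
  [/\ convex_set G, G `<=` F &
      forall (x y : 'rV[R]_n) (t : R), F x -> F y -> 0 < t < 1 ->
        G ((1 - t) *: x + t *: y) -> G x /\ G y].

Definition extreme_point (R : realType) (n : nat) (F : set 'rV[R]_n)
    (v : 'rV[R]_n) : Prop :=
  F v /\
  forall (x y : 'rV[R]_n) (t : R), F x -> F y -> 0 < t < 1 ->
    v = (1 - t) *: x + t *: y -> x = v /\ y = v.

(* [U] is the linear span of [G - G], i.e. the direction of the affine hull of
   a nonempty [G]; this determines [U]. *)
Definition direction (R : realType) (n : nat) (G : set 'rV[R]_n)
    (U : {vspace 'rV[R]_n}) : Prop :=
  forall W : {vspace 'rV[R]_n},
    (U <= W)%VS <-> (forall x y, G x -> G y -> x - y \in W).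

Definition has_dim (R : realType) (n : nat) (G : set 'rV[R]_n) (d : nat) :
    Prop :=
  G !=set0 /\ exists2 U : {vspace 'rV[R]_n}, direction G U & \dim U = d.

Definition side (R : realType) (F E : set 'rV[R]_2) : Prop :=
  face F E /\ has_dim E 1.

Definition parallel (R : realType) (n : nat) (E1 E2 : set 'rV[R]_n) : Prop :=
  exists2 U : {vspace 'rV[R]_n}, direction E1 U & direction E2 U.

(* Main.v *)
(* Write F as an irredundant intersection of halfplanes a_i.x <= b_i; every
   constraint then carries a side, so the normals are pairwise non-parallel.
   Orient each side by its normal.  A vertex is the final end of only one side,
   so with two vertices at most two sides have a final end; a side without one
   satisfies cross(a_i, a_l) < 0 for every other l, and at most one side does.
   Hence there are three sides, with normals a1, a2, a3 such that cross(a1, a2),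
   cross(a2, a3) and cross(a1, a3) are positive.

   Put s2 = s1 + 2 cross(a2, a3) a1 and t2 = s1 + 2 cross(a1, a3) a2.  The
   Plucker relation cross(a2, a3) a1 + cross(a1, a2) a3 = cross(a1, a3) a2 gives
   t2 = s2 + 2 cross(a1, a2) a3, so the bisectors of (s1, t2) and (s2, t2) are
   parallel to the sides 2 and 3; a suitable s1 makes them these sides.  The
   reflection t1 of s1 in side 1 lies on the line s1 s2 beyond s2, so the last
   bisector, that of (s2, t1), is parallel to side 1 and outside F. *)
Require Import Defs.
From mathcomp Require Import all_boot all_order all_algebra finmap.
From mathcomp Require Import all_classical all_reals all_analysis.
From mathcomp Require Import ring lra.

Import Order.TTheory GRing.Theory Num.Theory.
Import numFieldNormedType.Exports.

Set Implicit Arguments.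
Unset Strict Implicit.
Unset Printing Implicit Defensive.

Local Open Scope classical_set_scope.
Local Open Scope ring_scope.
Local Open Scope card_scope.

(** * Plane vectors: inner product, quarter turn and cross product *)

Lemma dotp2E (R : realType) (x y : 'rV[R]_2) :
  dotp x y = x 0 0 * y 0 0 + x 0 1 * y 0 1.
Proof.
rewrite /dotp !big_ord_recl big_ord0 addr0.
by have -> : lift ord0 ord0 = 1 :> 'I_2 by exact/val_inj.
Qed.

Lemma rV2P (R : realType) (x y : 'rV[R]_2) :
  x 0 0 = y 0 0 -> x 0 1 = y 0 1 -> x = y.
Proof.
move=> h0 h1; apply/rowP => i.
have [->|->] : i = 0 \/ i = 1; last 2 first.
- exact: h0.
- exact: h1.
by case: i => [[|[|i]] Hi] //; [left|right]; exact/val_inj.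
Qed.

Definition row2 (R : realType) (a b : R) : 'rV[R]_2 :=
  \row_j (if j == 0 then a else b).

(** The counterclockwise quarter turn. For an outer normal [u], running along [perp u] keeps the
    polygon on the left. *)
Definition perp (R : realType) (u : 'rV[R]_2) : 'rV[R]_2 :=
  row2 (- u 0 1) (u 0 0).

Definition cross (R : realType) (u v : 'rV[R]_2) : R :=
  u 0 0 * v 0 1 - u 0 1 * v 0 0.

Lemma dotp_perp (R : realType) (u v : 'rV[R]_2) : dotp u (perp v) = cross v u.
Proof. by rewrite dotp2E /cross !mxE /=; ring. Qed.

Lemma crossC (R : realType) (u v : 'rV[R]_2) : cross u v = - cross v u.
Proof. by rewrite /cross; ring. Qed.

Lemma crossxx (R : realType) (u : 'rV[R]_2) : cross u u = 0.
Proof. by rewrite /cross; ring. Qed.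

Lemma dotpDr (R : realType) (u v w : 'rV[R]_2) :
  dotp u (v + w) = dotp u v + dotp u w.
Proof. by rewrite !dotp2E !mxE; ring. Qed.

Lemma dotpBr (R : realType) (u v w : 'rV[R]_2) :
  dotp u (v - w) = dotp u v - dotp u w.
Proof. by rewrite !dotp2E !mxE; ring. Qed.

Lemma dotpZr (R : realType) (u v : 'rV[R]_2) (c : R) :
  dotp u (c *: v) = c * dotp u v.
Proof. by rewrite !dotp2E !mxE; ring. Qed.

Lemma dotp_gt0 (R : realType) (u : 'rV[R]_2) : u != 0 -> 0 < dotp u u.
Proof.
move=> u0; rewrite dotp2E -!expr2 lt0r addr_ge0 ?sqr_ge0// andbT.
rewrite paddr_eq0 ?sqr_ge0// !sqrf_eq0; apply: contra u0.
by move=> /andP[/eqP h0 /eqP h1]; apply/eqP/rV2P; rewrite ?h0 ?h1 mxE.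
Qed.

Lemma perp_neq0 (R : realType) (u : 'rV[R]_2) : u != 0 -> perp u != 0.
Proof.
move=> /dotp_gt0; rewrite dotp2E => u0; apply/eqP => p0; move: u0.
have := congr1 (fun w : 'rV[R]_2 => w 0 0) p0; rewrite !mxE/= => /eqP.
have := congr1 (fun w : 'rV[R]_2 => w 0 1) p0; rewrite !mxE/= => ->.
by rewrite oppr_eq0 => /eqP ->; rewrite !mulr0 addr0 ltxx.
Qed.

(** Cramer's rule: [cross u v] times a coordinate of [x] is a combination of [dotp u x] and
    [dotp v x]. *)
Lemma dotp_inj2 (R : realType) (u v x y : 'rV[R]_2) :
  cross u v != 0 -> dotp u x = dotp u y -> dotp v x = dotp v y -> x = y.
Proof.
rewrite !dotp2E /cross => c0 hu hv.
apply: rV2P; apply: (mulfI c0).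
- have -> : (u 0 0 * v 0 1 - u 0 1 * v 0 0) * x 0 0 =
     v 0 1 * (u 0 0 * x 0 0 + u 0 1 * x 0 1) -
     u 0 1 * (v 0 0 * x 0 0 + v 0 1 * x 0 1) by ring.
  by rewrite hu hv; ring.
- have -> : (u 0 0 * v 0 1 - u 0 1 * v 0 0) * x 0 1 =
     u 0 0 * (v 0 0 * x 0 0 + v 0 1 * x 0 1) -
     v 0 0 * (u 0 0 * x 0 0 + u 0 1 * x 0 1) by ring.
  by rewrite hu hv; ring.
Qed.

Lemma dotp0_colinear (R : realType) (a u v : 'rV[R]_2) : a != 0 -> u != 0 ->
  dotp a u = 0 -> dotp a v = 0 -> exists k, v = k *: u.
Proof.
move=> /dotp_gt0 a0 /dotp_gt0 u0 au av; exists (dotp u v / dotp u u).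
have c0 : cross a u != 0.
  apply/eqP => c0; have : dotp a a * dotp u u = 0.
    (* Lagrange's identity. *)
    have -> : dotp a a * dotp u u = cross a u ^+ 2 + dotp a u ^+ 2.
      by rewrite !dotp2E /cross; ring.
    by rewrite c0 au expr0n addr0.
  by apply/eqP; rewrite mulf_neq0// gt_eqF.
apply: (dotp_inj2 c0); rewrite dotpZr ?au ?av ?mulr0//.
by rewrite divfK// gt_eqF.
Qed.

(** * Polyhedra, their facets and the directions of facets *)

Lemma small_multiple (R : realType) (J : finType) (c d : J -> R) :
  (forall j, 0 < d j) -> exists2 e : R, 0 < e & forall j, e * c j <= d j.
Proof.
move=> d0; pose g j := d j / (1 + `|c j|).
have c1 j : 0 < 1 + `|c j| by rewrite ltr_wpDr.
(* The base value 1 keeps the minimum positive even for empty [J]. *)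
exists (\big[Order.min/1]_j g j).
  by apply: lt_bigmin => // j _; rewrite divr_gt0.
move=> j; set e := \big[_/_]_j _.
have eg : e <= g j by exact: bigmin_le.
have e0 : 0 < e by apply: lt_bigmin => // i _; rewrite divr_gt0.
have : e * (1 + `|c j|) <= d j by rewrite -ler_pdivlMr.
apply: le_trans; rewrite ler_wpM2l// ?(ltW e0)//.
by rewrite (le_trans (ler_norm _))// lerDr.
Qed.

Definition polyhedron (R : realType) (J : Type) (a : J -> 'rV[R]_2) (b : J -> R)
  : set 'rV[R]_2 := [set x | forall j, dotp (a j) x <= b j].

(** From an interior point a short step along [a] stays in [F] and strictly increases [dotp a]. *)
Lemma interior_halfplane (R : realType) (F : set 'rV[R]_2) (a z : 'rV[R]_2)
    (b : R) :
  a != 0 -> (forall x, F x -> dotp a x <= b) -> F° z -> dotp a z < b.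
Proof.
move=> a0 Fab /nbhs_ballP[r /= r0 rF].
have n0 : 0 < 1 + `|a| by rewrite ltr_wpDr.
pose e := r / 2 / (1 + `|a|).
have e0 : 0 < e by rewrite !divr_gt0.
have /Fab : F (z + e *: a).
  apply: rF; rewrite -ball_normE /ball_ /= opprD addrA subrr sub0r normrN normrZ.
  rewrite gtr0_norm// /e mulrAC ltr_pdivrMr//.
  have := normr_ge0 a; set n := `|a|; nra.
rewrite dotpDr dotpZr; apply: lt_le_trans.
by rewrite ltrDl mulr_gt0// dotp_gt0.
Qed.

(** Such an [e] is a relative interior point of facet [i] and witnesses that constraint [i] is
    irredundant. *)
Definition sole_tight (R : realType) (J : eqType) (a : J -> 'rV[R]_2)
    (b : J -> R) (i : J) (e : 'rV[R]_2) : Prop :=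
  dotp (a i) e = b i /\ forall j, j != i -> dotp (a j) e < b j.

(** The segment from [z0] to [z] crosses line [i] before reaching [z], so the strict slack at [z0]
    keeps the other constraints strict there. *)
Lemma sole_tight_exists (R : realType) (J : eqType) (a : J -> 'rV[R]_2)
    (b : J -> R) (i : J) (z0 z : 'rV[R]_2) :
  (forall j, dotp (a j) z0 < b j) ->
  b i < dotp (a i) z -> (forall j, j != i -> dotp (a j) z <= b j) ->
  exists e, sole_tight a b i e.
Proof.
move=> hz0 hi hz; have hi0 := hz0 i.
pose t := (b i - dotp (a i) z0) / (dotp (a i) z - dotp (a i) z0).
have den : 0 < dotp (a i) z - dotp (a i) z0 by rewrite subr_gt0 (lt_trans hi0).
have t0 : 0 < t by rewrite divr_gt0// subr_gt0.
have t1 : t < 1 by rewrite ltr_pdivrMr// mul1r ltrD2r.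
exists (z0 + t *: (z - z0)); split=> [|j ji]; rewrite dotpDr dotpZr dotpBr.
  by rewrite /t divfK ?gt_eqF// addrC subrK.
have := hz0 j; have := hz _ ji; nra.
Qed.

Lemma sole_tight_mem (R : realType) (J : eqType) (a : J -> 'rV[R]_2)
    (b : J -> R) (i : J) (e : 'rV[R]_2) :
  sole_tight a b i e -> polyhedron a b e.
Proof.
by move=> [ei ej] j; have [->|/ej/ltW//] := eqVneq j i; rewrite ei.
Qed.

Definition facet (R : realType) (J : Type) (a : J -> 'rV[R]_2) (b : J -> R)
    (i : J) : set 'rV[R]_2 := [set x | polyhedron a b x /\ dotp (a i) x = b i].

Lemma polyhedron_wiggle (R : realType) (J : finType) (a : J -> 'rV[R]_2)
    (b : J -> R) (x u : 'rV[R]_2) :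
  polyhedron a b x ->
  (forall j, dotp (a j) x = b j -> dotp (a j) u = 0) ->
  exists2 e : R, 0 < e &
    polyhedron a b (x + e *: u) /\ polyhedron a b (x - e *: u).
Proof.
move=> Px ux.
(* Tight constraints do not change along [u], so 1 is a dummy bound for them; the others use their
   slack. *)
pose d j := if dotp (a j) x == b j then 1 else b j - dotp (a j) x.
have d0 j : 0 < d j.
  by rewrite /d; case: eqVneq => // neq; rewrite subr_gt0 lt_neqAle neq Px.
have [e e0 he] := small_multiple (fun j => `|dotp (a j) u|) d0.
exists e => //; split=> j; rewrite ?dotpBr ?dotpDr dotpZr; have := he j;
  rewrite /d; case: eqVneq => [xj _|_]; try by rewrite (ux _ xj) mulr0 ?subr0 ?addr0.
- have := ler_norm (dotp (a j) u); nra.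
- have := ler_norm (- dotp (a j) u); rewrite normrN; nra.
Qed.

(** The facet lies on a line parallel to [u], and from [e] it contains a step along [u], so its
    direction is the whole line. *)
Lemma facet_direction (R : realType) (J : finType) (a : J -> 'rV[R]_2)
    (b : J -> R) (i : J) (e u : 'rV[R]_2) :
  a i != 0 -> sole_tight a b i e -> u != 0 -> dotp (a i) u = 0 ->
  direction (facet a b i) <[u]>%VS.
Proof.
move=> ai0 ie u0 aiu W; rewrite -memvE; split=> [uW x y [_ xi] [_ yi]|hW].
  have xy0 : dotp (a i) (x - y) = 0 by rewrite dotpBr xi yi subrr.
  by have [k ->] := dotp0_colinear ai0 u0 aiu xy0; rewrite memvZ.
have [|r r0 [Pr _]] := polyhedron_wiggle (u := u) (sole_tight_mem ie).
  case: ie => [ei ej] j; have [->//|/ej ltj eqj] := eqVneq j i.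
  by rewrite eqj ltxx in ltj.
have /hW : facet a b i (e + r *: u).
  by split=> //; rewrite dotpDr dotpZr aiu mulr0 addr0; case: ie.
move=> /(_ e); rewrite addrAC subrr add0r rpredZeq gt_eqF//=; apply.
by split; [exact: sole_tight_mem ie|case: ie].
Qed.

Lemma conv_lmodE (R : realType) (n : nat) (x y : 'rV[R]_n) (t : {i01 R}) :
  conv t (x : convex_lmodType _) (y : convex_lmodType _) =
  t%:num *: x + (1 - t%:num) *: y.
Proof. by []. Qed.

Lemma facet_side (R : realType) (J : finType) (a : J -> 'rV[R]_2)
    (b : J -> R) (i : J) (e : 'rV[R]_2) :
  a i != 0 -> sole_tight a b i e ->
  side (polyhedron a b) (facet a b i).
Proof.
move=> ai0 ie; split; last first.
  split; first by exists e; split; [exact: sole_tight_mem ie|case: ie].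
  exists <[perp (a i)]>%VS; last by rewrite dim_vline perp_neq0.
  by apply: (facet_direction _ ie); rewrite ?perp_neq0 ?dotp_perp ?crossxx.
split; last 2 first.
- by move=> x [].
- move=> x y t Px Py /andP[t0 t1] [_].
  rewrite dotpDr !dotpZr => h; have := Px i; have := Py i => yi xi.
  by split; split => //; nra.
- move=> x y t; rewrite !inE => -[Px xi] [Py yi].
  rewrite conv_lmodE.
  have t0 : 0 <= t%:num by [].
  have t1 : t%:num <= 1 by [].
  split=> [j|]; rewrite dotpDr !dotpZr.
    have := Px j; have := Py j; nra.
  by rewrite xi yi; ring.
Qed.

(** Parallel normals would give two facets the same direction; these facets differ because [e i]
    lies on facet [i] only. *)
Lemma facets_cross_neq0 (R : realType) (J : finType) (a : J -> 'rV[R]_2)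
    (b : J -> R) (e : J -> 'rV[R]_2) :
  (forall i, a i != 0) -> (forall i, sole_tight a b i (e i)) ->
  (forall E1 E2 : set 'rV[R]_2, side (polyhedron a b) E1 ->
     side (polyhedron a b) E2 -> E1 <> E2 -> ~ parallel E1 E2) ->
  forall i j, i != j -> cross (a i) (a j) != 0.
Proof.
move=> a0 he hp i j ij; apply/eqP => c0.
apply: (hp (facet a b i) (facet a b j)).
- exact: facet_side (he i).
- exact: facet_side (he j).
- move=> fij; have : facet a b i (e i).
    by split; [exact: sole_tight_mem|case: (he i)].
  rewrite fij => -[_ eij]; have [_ /(_ j)] := he i.
  by rewrite eij ltxx eq_sym ij => /(_ isT).
- exists <[perp (a i)]>%VS; apply: facet_direction (he _) _ _;
    by rewrite ?perp_neq0 ?dotp_perp ?crossxx.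
Qed.

(** * Final ends of facets *)

(* [v] is the end of the facet [i] when running along it in the direction
   [perp (a i)]. *)
Definition facet_end (R : realType) (J : Type) (a : J -> 'rV[R]_2)
    (b : J -> R) (i : J) (v : 'rV[R]_2) : Prop :=
  facet a b i v /\ exists2 j, dotp (a j) v = b j & 0 < cross (a i) (a j).

(** Two constraints tight inside a segment are tight at both its ends, and two lines that are not
    parallel meet only once. *)
Lemma facet_end_extreme (R : realType) (J : Type) (a : J -> 'rV[R]_2)
    (b : J -> R) (i : J) (v : 'rV[R]_2) :
  facet_end a b i v -> extreme_point (polyhedron a b) v.
Proof.
move=> [[Pv vi] [j vj c0]]; split=> // x y t Px Py /andP[t0 t1] vE.
have cn : cross (a i) (a j) != 0 by rewrite gt_eqF.
move: vi vj; rewrite vE !dotpDr !dotpZr -vE => vi vj.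
have := Px i; have := Py i; have := Px j; have := Py j => yj xj yi xi.
have xi' : dotp (a i) x = b i by nra.
have xj' : dotp (a j) x = b j by nra.
have yi' : dotp (a i) y = b i by nra.
have yj' : dotp (a j) y = b j by nra.
by split; apply: (dotp_inj2 cn);
  rewrite ?xi' ?xj' ?yi' ?yj' vE !dotpDr !dotpZr ?xi' ?xj' ?yi' ?yj'; ring.
Qed.

Lemma facet_end_exists (R : realType) (J : finType) (a : J -> 'rV[R]_2)
    (b : J -> R) (i j : J) (e : 'rV[R]_2) :
  sole_tight a b i e -> 0 < cross (a i) (a j) ->
  exists v, facet_end a b i v.
Proof.
move=> [ei ej] cij.
(* Ratio test: [f j] is the time at which the ray from [e] along [perp (a i)] meets line [j]; the
   first such meeting is the end. *)
pose f j := (b j - dotp (a j) e) / cross (a i) (a j).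
case: (@arg_minP _ _ _ j (fun j => 0 < cross (a i) (a j)) f cij) => m cim hm.
have ne k : 0 < cross (a i) (a k) -> k != i.
  by apply: contraTneq => ->; rewrite crossxx ltxx.
exists (e + f m *: perp (a i)); split; last first.
  exists m => //; rewrite dotpDr dotpZr dotp_perp /f divfK ?gt_eqF//.
  by rewrite addrC subrK.
have f0 : 0 < f m by rewrite divr_gt0// subr_gt0 ej// ne.
split; last by rewrite dotpDr dotpZr dotp_perp crossxx mulr0 addr0.
move=> k; rewrite dotpDr dotpZr dotp_perp.
have [->|ki] := eqVneq k i; first by rewrite crossxx mulr0 addr0 ei.
have [ck|ck] := ltP 0 (cross (a i) (a k)).
  by have := hm _ ck; rewrite {2}/f ler_pdivlMr// -lerBrDl.
have := ej _ ki; nra.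
Qed.

(** A common end of two distinct facets would make their cross product positive in both orders. *)
Lemma facet_end_inj (R : realType) (J : eqType) (a : J -> 'rV[R]_2)
    (b : J -> R) (e : J -> 'rV[R]_2) (i j : J) (v : 'rV[R]_2) :
  (forall i, sole_tight a b i (e i)) ->
  facet_end a b i v -> facet_end a b j v -> i = j.
Proof.
move=> he iv jv; apply/eqP; apply: contraT => ij.
(* Along the facet [k], constraint [l], tight at the end [v] and slack before
   it, must increase. *)
have key k l : k != l -> facet_end a b k v -> dotp (a l) v = b l ->
    0 < cross (a k) (a l).
  move=> kl [[_ vk] [m vm ckm]] vl.
  have [ek ek'] := he k.
  have mk : m != k by apply: contraTneq ckm => ->; rewrite crossxx ltxx.
  have lk := ek' l; rewrite eq_sym kl in lk; have := lk isT; have := ek' _ mk.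
  have ak0 : a k != 0.
    by apply: contraTneq ckm => ->; rewrite /cross !mxE; lra.
  have [||t vE] := dotp0_colinear (v := v - e k) ak0 (perp_neq0 ak0).
  - by rewrite dotp_perp crossxx.
  - by rewrite dotpBr vk ek; ring.
  have /eqP := vE; rewrite subr_eq => /eqP {}vE.
  move: vm vl; rewrite vE !dotpDr !dotpZr !dotp_perp => vm vl h1 h2.
  have t0 : 0 < t by nra.
  by rewrite -(pmulr_rgt0 _ t0); lra.
have := key i j ij iv; have := key j i; rewrite eq_sym ij => /(_ isT jv).
case: iv => -[_ vi] _; case: jv => -[_ vj] _ /(_ vi) h /(_ vj).
by rewrite crossC oppr_gt0 ltNge ltW.
Qed.

(** * Two vertices leave exactly three facets *)

(** With at most one tight constraint, [v] could move both ways along some nonzero [u] and would be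
    the midpoint of a segment. *)
Lemma extreme_point_tight2 (R : realType) (J : finType) (a : J -> 'rV[R]_2)
    (b : J -> R) (v : 'rV[R]_2) :
  (forall i, a i != 0) -> extreme_point (polyhedron a b) v ->
  exists i j, [/\ i != j, dotp (a i) v = b i & dotp (a j) v = b j].
Proof.
move=> a0 [Pv ext]; apply: contrapT => no.
have [u u0 hu] : exists2 u : 'rV[R]_2, u != 0 &
    forall j, dotp (a j) v = b j -> dotp (a j) u = 0.
  have [[i vi]|none] := pselect (exists i, dotp (a i) v = b i).
    exists (perp (a i)); rewrite ?perp_neq0// => j vj.
    have [->|ji] := eqVneq j i; first by rewrite dotp_perp crossxx.
    by case: no; exists j, i.
  exists (row2 1 0).
    apply/eqP => /(congr1 (fun w : 'rV[R]_2 => w 0 0)); rewrite !mxE /= => /eqP.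
    by rewrite oner_eq0.
  by move=> j vj; case: none; exists j.
have [e e0 [P1 P2]] := polyhedron_wiggle Pv hu.
have [||] := ext _ _ (2^-1) P1 P2.
- by rewrite invr_gt0 ltr0n invf_lt1 ?ltr1n ?ltr0n.
- by apply: rV2P; rewrite !mxE; field.
move=> /eqP; rewrite -subr_eq0 addrAC subrr add0r scaler_eq0 (negbTE u0) orbF.
by rewrite gt_eqF.
Qed.

Lemma card_I2P (T : Type) (A : set T) : A #= `I_2 ->
  exists p q, [/\ p <> q, A p, A q & forall v, A v -> v = p \/ v = q].
Proof.
move=> /eq_cardSP[p Ap /eq_cardSP[q [Aq /= qp]]].
rewrite II0 card_eq0 => /eqP A0; exists p, q; split=> // [pq|v Av].
  exact/qp.
have [|vp] := pselect (v = p); [by left|right].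
apply: contrapT => vq; suff : ((A `\ p) `\ q) v by rewrite A0.
by split.
Qed.

(** The index [k] found is the facet without a final end; the sign of the cross product of the other
    two normals orders them. *)
Lemma polyhedron_2vertices (R : realType) (J : finType) (a : J -> 'rV[R]_2)
    (b : J -> R) (e : J -> 'rV[R]_2) :
  (forall i, a i != 0) -> (forall i, sole_tight a b i (e i)) ->
  (forall i j, i != j -> cross (a i) (a j) != 0) ->
  [set v | extreme_point (polyhedron a b) v] #= `I_2 ->
  exists i j k, [/\ forall l, l \in [:: i; j; k], 0 < cross (a i) (a j),
    0 < cross (a j) (a k) & 0 < cross (a i) (a k)].
Proof.
move=> a0 he hc /card_I2P[p [q [pq extp extq extE]]].
pose lacks i := forall l, l != i -> cross (a i) (a l) < 0.
have lacks_or_end i : lacks i \/ exists v, facet_end a b i v.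
  have [[l cl]|none] := pselect (exists l, 0 < cross (a i) (a l)).
    by right; exact: facet_end_exists (he i) cl.
  left=> l li; rewrite lt_neqAle hc 1?eq_sym//= leNgt.
  by apply/negP => cl; apply: none; exists l.
have lacks_uniq i j : lacks i -> lacks j -> i = j.
  move=> li lj; apply/eqP; apply: contraT => ij.
  have := lj _ ij; rewrite eq_sym in ij; have := li _ ij.
  by rewrite crossC; lra.
(* Three final ends would be three distinct vertices. *)
have lacks3 i j k : i != j -> j != k -> i != k ->
    exists2 x, x \in [:: i; j; k] & lacks x.
  move=> ij jk ik.
  have [li|[u iu]] := lacks_or_end i; first by exists i; rewrite // !inE eqxx.
  have [lj|[v jv]] := lacks_or_end j.
    by exists j; rewrite // !inE eqxx orbT.
  have [lk|[w kw]] := lacks_or_end k.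
    by exists k; rewrite // !inE eqxx !orbT.
  have inj x y z : facet_end a b x z -> facet_end a b y z -> x = y.
    by apply: facet_end_inj; exact: he.
  have Eu := extE _ (facet_end_extreme iu).
  have Ev := extE _ (facet_end_extreme jv).
  have Ew := extE _ (facet_end_extreme kw).
  have ne x y z z' : x != y -> facet_end a b x z -> facet_end a b y z' -> z <> z'.
    by move=> /eqP xy xz yz zz; apply: xy; apply: (inj _ _ z) => //; rewrite zz.
  have := ne _ _ _ _ ij iu jv; have := ne _ _ _ _ jk jv kw.
  have := ne _ _ _ _ ik iu kw.
  by case: Eu => ->; case: Ev => ->; case: Ew => ->.
have [i [j [ij pi pj]]] := extreme_point_tight2 a0 extp.
(* If only [i] and [j] were tight at [q], then [q] would be their intersection point [p]. *)
have [k [ik jk]] : exists k, i != k /\ j != k.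
  have [k [l [kl qk ql]]] := extreme_point_tight2 a0 extq.
  have out x : x \in [:: i; j] -> dotp (a x) p = b x.
    by rewrite !inE => /orP[] /eqP ->.
  have [kij|] := boolP (k \in [:: i; j]); last first.
    by rewrite !inE negb_or => /andP[ni nj]; exists k; rewrite !(eq_sym _ k).
  have [lij|] := boolP (l \in [:: i; j]); last first.
    by rewrite !inE negb_or => /andP[ni nj]; exists l; rewrite !(eq_sym _ l).
  by case: pq; apply: (dotp_inj2 (hc _ _ kl)); rewrite ?qk ?ql out.
have [x [y [z [yz xy xz lx]]]] :
    exists x y z, [/\ y != z, x != y, x != z & lacks x].
  have [x + lx] := lacks3 _ _ _ ij jk ik.
  rewrite !inE => /or3P[] /eqP xE; rewrite xE in lx.
  - by exists i, j, k.
  - by exists j, i, k; split; rewrite // eq_sym.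
  - by exists k, i, j; split; rewrite // eq_sym.
(* With a fourth facet [l], one of [y], [z], [l] would lack a final end besides [x]. *)
have all3 l : l \in [:: x; y; z].
  apply: contraT; rewrite !inE !negb_or => /and3P[lx' ly lz].
  rewrite eq_sym in ly; rewrite eq_sym in lz.
  have [w + lw] := lacks3 y z l yz lz ly.
  rewrite (lacks_uniq _ _ lw lx) !inE (negbTE xy) (negbTE xz) eq_sym.
  by rewrite (negbTE lx').
have cyx : 0 < cross (a y) (a x) by rewrite crossC oppr_gt0 lx// eq_sym.
have czx : 0 < cross (a z) (a x) by rewrite crossC oppr_gt0 lx// eq_sym.
have [cyz|cyz] := ltP 0 (cross (a y) (a z)).
  exists y, z, x; split=> // l.
  by have := all3 l; rewrite !inE; do 3!case: eqP.
exists z, y, x; split=> //; last first.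
  by rewrite crossC oppr_gt0 lt_neqAle cyz hc.
by move=> l; have := all3 l; rewrite !inE; do 3!case: eqP.
Qed.

(** * Irredundant systems of halfplanes *)

(** In a representation with the fewest constraints, each one is violated alone by some point;
    otherwise it could be dropped. *)
Lemma irredundant_halfplanes (R : realType) (F : set 'rV[R]_2) (k : nat)
    (H : 'I_k -> set 'rV[R]_2) :
  (forall i, closed_halfplane (H i)) -> F = \bigcap_i H i -> F° !=set0 ->
  exists (n : nat) (a : 'I_n -> 'rV[R]_2) (b : 'I_n -> R),
    [/\ F = polyhedron a b, forall i, a i != 0 &
        exists e, forall i, sole_tight a b i (e i)].
Proof.
move=> hH FE [z0 Fz0].
pose repr n := exists (a : 'I_n -> 'rV[R]_2) (b : 'I_n -> R),
  F = polyhedron a b /\ forall i, a i != 0.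
have reprk : exists n, `[< repr n >].
  exists k; apply/asboolP.
  have /choice[ab hab] i : exists ab : 'rV[R]_2 * R,
      ab.1 != 0 /\ H i = [set x | dotp ab.1 x <= ab.2].
    by have [a a0 [b ->]] := hH i; exists (a, b).
  exists (fun i => (ab i).1), (fun i => (ab i).2); split=> [|i]; last first.
    by have [] := hab i.
  rewrite FE; apply/seteqP; split=> x /= hx i.
    by have := hx i I; have [_ ->] := hab i.
  by move=> _; have [_ ->] := hab i; exact: hx.
case: (ex_minnP reprk) => n /asboolP[a [b [FP a0]]] nmin.
exists n, a, b; split=> //.
suff /choice[e he] : forall i, exists e, sole_tight a b i e by exists e.
move=> i.
have hz0 j : dotp (a j) z0 < b j.
  by apply: interior_halfplane (a0 j) _ Fz0 => x; rewrite FP; exact.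
suff [z zi hz] : exists2 z, b i < dotp (a i) z &
    forall j, j != i -> dotp (a j) z <= b j.
  exact: sole_tight_exists hz0 zi hz.
apply: contrapT => no.
case: n a b FP a0 nmin i hz0 no => [? ? ? ? ? []//|n] a b FP a0 nmin i hz0 no.
suff /asboolP/nmin : repr n by rewrite ltnn.
exists (a \o lift i), (b \o lift i); split=> [|j]; last exact: a0.
rewrite FP; apply/seteqP; split=> x hx j /=; first exact: hx.
have hx' l : l != i -> dotp (a l) x <= b l.
  by rewrite eq_sym => /unlift_some[m -> _]; exact: hx.
have [->|/hx'//] := eqVneq j i.
by rewrite leNgt; apply/negP => xi; apply: no; exists x.
Qed.

(** * Bisectors and the construction of the sites *)

(** The difference of the squared distances is [4 * c] times the slack of the halfplane
    inequality. *)
Lemma enorm_le_halfplane (R : realType) (a s x : 'rV[R]_2) (c : R) : 0 < c ->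
  (enorm (x - s) <= enorm (x - (s + (2 * c) *: a))) =
  (dotp a x <= dotp a s + c * dotp a a).
Proof.
move=> c0; rewrite /enorm ler_sqrt; last first.
  by rewrite dotp2E -!expr2 addr_ge0// sqr_ge0.
rewrite -subr_ge0 -[RHS]subr_ge0 -[RHS](pmulr_rge0 _ (_ : 0 < 4 * c)); last first.
  by rewrite mulr_gt0.
by congr (0 <= _); rewrite !dotp2E !mxE; ring.
Qed.

Lemma voronoi_cellE (R : realType) (n : nat) (T S : {fset 'rV[R]_n}) :
  voronoi_cell T S = [set x | forall s t, s \in S -> t \in (T `\` S)%fset ->
    enorm (x - s) <= enorm (x - t)].
Proof.
apply/seteqP; split=> x /= => [hx s t sS tT|hx].
  rewrite -lee_fin.
  apply: (le_trans (le_bigmax_seq -oo%E s xpredT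
    (fun s => (enorm (x - s))%:E) sS isT)).
  apply: (le_trans hx).
  exact: (ge_bigmin_seq +oo%E t xpredT
    (fun t => (enorm (x - t))%:E) tT isT).
rewrite /voronoi_cell /= big_seq; apply: bigmax_le => [|s sS]; first exact: leNye.
rewrite big_seq; apply: le_bigmin => [|t tT]; first exact: leey.
by rewrite lee_fin; exact: hx.
Qed.

(** The point [q] is the corner of sides 2 and 3, strictly inside the halfplane of side 1. *)
Lemma voronoi_cell_3halfplanes (R : realType) (a1 a2 a3 q : 'rV[R]_2) (b : R) :
  0 < cross a1 a2 -> 0 < cross a2 a3 -> 0 < cross a1 a3 -> dotp a1 q < b ->
  exists S T : {fset 'rV[R]_2},
    [/\ (S `<=` T)%fset, #|` S| = 2%N, #|` T| = 4%N &
        voronoi_cell T S = [set x | [/\ dotp a1 x <= b,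
          dotp a2 x <= dotp a2 q & dotp a3 x <= dotp a3 q]]].
Proof.
move=> c12 c23 c13 qb.
have nz (u v : 'rV[R]_2) : 0 < cross u v -> u != 0 /\ v != 0.
  by move=> h; split; apply: contraTneq h => ->; rewrite /cross !mxE; lra.
have [a10 a20] := nz _ _ c12; have [_ a30] := nz _ _ c23.
have a11 := dotp_gt0 a10.
(* Moving from [q] by [g *: a1] reaches side 1. *)
pose g := (b - dotp a1 q) / dotp a1 a1.
have g0 : 0 < g by rewrite divr_gt0// subr_gt0.
(* In complex notation, s1 = q - i a1 a2 conj(a3). *)
pose s1 := q + row2
  (a1 0 0 * a2 0 1 * a3 0 0 + a1 0 1 * a2 0 0 * a3 0 0
   - a1 0 0 * a2 0 0 * a3 0 1 + a1 0 1 * a2 0 1 * a3 0 1)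
  (a1 0 1 * a2 0 1 * a3 0 0 - a1 0 0 * a2 0 0 * a3 0 0
   - a1 0 0 * a2 0 1 * a3 0 1 - a1 0 1 * a2 0 0 * a3 0 1).
pose s2 := s1 + (2 * cross a2 a3) *: a1.
pose t1 := s1 + (2 * (cross a2 a3 + g)) *: a1.
pose t2 := s1 + (2 * cross a1 a3) *: a2.
have t1E : t1 = s2 + (2 * g) *: a1.
  by rewrite /s2 -addrA -scalerDl -mulrDr.
have t2E : t2 = s2 + (2 * cross a1 a2) *: a3.
  by rewrite /t2 /s2 /cross; apply: rV2P; rewrite !mxE; ring.
(* The three identities say that [q] is the circumcentre of the triangle [s1], [s2], [t2]. *)
have m1 : dotp a1 s1 + cross a2 a3 * dotp a1 a1 = dotp a1 q.
  by rewrite !dotp2E !mxE /= /cross; ring.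
have m2 : dotp a2 s1 + cross a1 a3 * dotp a2 a2 = dotp a2 q.
  by rewrite !dotp2E !mxE /= /cross; ring.
have m3 : dotp a3 s2 + cross a1 a2 * dotp a3 a3 = dotp a3 q.
  by rewrite !dotp2E !mxE /= /cross; ring.
have ne (s u : 'rV[R]_2) k : 0 < k -> u != 0 -> (s == s + (2 * k) *: u) = false.
  move=> k0 u0; apply: negbTE; rewrite -subr_eq0 opprD addrA subrr sub0r.
  by rewrite oppr_eq0 scaler_eq0 negb_or u0 mulf_neq0// gt_eqF.
have cg : 0 < cross a2 a3 + g by rewrite addr_gt0.
have s12 : (s1 == s2) = false by exact: ne.
have s1t1 : (s1 == t1) = false by exact: ne.
have s1t2 : (s1 == t2) = false by exact: ne.
have s2t1 : (s2 == t1) = false by rewrite t1E; exact: ne.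
have s2t2 : (s2 == t2) = false by rewrite t2E; exact: ne.
have t12 : (t1 == t2) = false.
  (* Seen from [s1], [t1] lies along [a1], while [t2] lies strictly to the left of that
     direction. *)
  apply/eqP => /addrI /(congr1 (cross a1)); rewrite /cross !mxE => h.
  have := mulr_gt0 c13 c12; rewrite /cross; nra.
pose S := [fset s1; s2]%fset; pose T := [fset s1; s2; t1; t2]%fset.
exists S, T; split.
- by apply/fsubsetP => x; rewrite !inE => /orP[] ->; rewrite ?orbT.
- by rewrite cardfs2 s12.
- have -> : T = (s1 |` (s2 |` [fset t1; t2]))%fset.
    by apply/fsetP => x; rewrite !inE -!orbA.
  by rewrite !cardfsU1 cardfs1 !inE s12 s1t1 s1t2 s2t1 s2t2 t12.
have TS t : t \in (T `\` S)%fset = (t == t1) || (t == t2).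
  rewrite !inE; have [->|_] := eqVneq t s1; first by rewrite s1t1 s1t2.
  by have [->|] := eqVneq t s2; rewrite ?s2t1 ?s2t2.
have h11 x : (enorm (x - s1) <= enorm (x - t1)) = (dotp a1 x <= b).
  by rewrite enorm_le_halfplane// mulrDl addrA m1 divfK ?gt_eqF// addrC subrK.
(* This bisector is side 1 with [b] raised by [cross a2 a3 * dotp a1 a1]. *)
have h21 x : dotp a1 x <= b -> enorm (x - s2) <= enorm (x - t1).
  move=> xb; rewrite t1E enorm_le_halfplane// divfK ?gt_eqF//.
  rewrite dotpDr dotpZr; have := mulr_gt0 c23 a11; move: m1; lra.
have h12 x : (enorm (x - s1) <= enorm (x - t2)) = (dotp a2 x <= dotp a2 q).
  by rewrite enorm_le_halfplane// m2.
have h22 x : (enorm (x - s2) <= enorm (x - t2)) = (dotp a3 x <= dotp a3 q).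
  by rewrite t2E enorm_le_halfplane// m3.
rewrite voronoi_cellE; apply/seteqP; split=> x /= => [hx|[x1 x2 x3] s t].
  by rewrite -h11 -h12 -h22; split; apply: hx; rewrite ?TS ?inE ?eqxx ?orbT.
rewrite TS !inE => /orP[] /eqP -> /orP[] /eqP ->.
- by rewrite h11.
- by rewrite h12.
- exact: h21.
- by rewrite h22.
Qed.

(** * The sites for the given polygon *)

Unset Implicit Arguments.

Theorem proposition3p9 (R : realType) (F : set 'rV[R]_2)
    (Fpoly : unbounded_convex_polygon F)
    (Fsides : forall E1 E2 : set 'rV[R]_2,
       side F E1 -> side F E2 -> E1 <> E2 -> ~ parallel E1 E2)
    (Fvertices : [set v | extreme_point F v] #= `I_2) :
  exists S T : {fset 'rV[R]_2},
    [/\ (S `<=` T)%fset, #|` S| = 2%N, #|` T| = 4%N & voronoi_cell T S = F].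
Proof.
have [[m [H [hH FE]]] Fint _] := Fpoly.
have [n [a [b [FP a0 [e he]]]]] := irredundant_halfplanes hH FE Fint.
rewrite FP in Fsides Fvertices *.
have hc := facets_cross_neq0 a0 he Fsides.
have [i [j [k [ijk cij cjk cik]]]] := polyhedron_2vertices a0 he hc Fvertices.
have [eij ej] := he j.
have ik : i != j by apply: contraTneq cij => ->; rewrite crossxx ltxx.
have kj : k != j by apply: contraTneq cjk => ->; rewrite crossxx ltxx.
(* Running from [e j] along side [j] for time [r] reaches line [k], at the corner [q]. *)
pose r := (b k - dotp (a k) (e j)) / cross (a j) (a k).
have r0 : 0 < r by rewrite divr_gt0// subr_gt0 ej.
pose q := e j + r *: perp (a j).
(* Constraint [i] is strict at [e j] and its left side decreases on the way to [q]. *)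
have qi : dotp (a i) q < b i.
  rewrite dotpDr dotpZr dotp_perp crossC mulrN.
  have := ej _ ik; have := mulr_gt0 r0 cij; lra.
have qj : dotp (a j) q = b j.
  by rewrite dotpDr dotpZr dotp_perp crossxx mulr0 addr0.
have qk : dotp (a k) q = b k.
  by rewrite dotpDr dotpZr dotp_perp divfK ?gt_eqF// addrC subrK.
have [S [T [ST S2 T4 STE]]] := voronoi_cell_3halfplanes cij cjk cik qi.
exists S, T; split=> //; rewrite STE; apply/seteqP; split=> x /= => [|Px].
  rewrite qj qk => -[xi xj xk] l.
  by have := ijk l; rewrite !inE => /or3P[] /eqP ->.
by rewrite qj qk; split; exact: Px.
Qed.
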